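(* Let $K$ be an interface element and let $\{p_i\}_{i=0}^m$ be a basis of $\mathcal P^m(\hat\Gamma_{K_F})$. For $0\le i\le m$ and $1\le j\le m$ let $\hat\phi_{i,j}(\eta,\xi)=\frac{1}{\hat\beta(\eta,\xi)}\eta^jp_i(\xi)$ on $\hat K_F$. For $0\le i\le m$ let $\hat\phi_{i,0}$ be the unique element of $\hat{\mathcal V}^m_{\hat\beta}(\hat K_F)$ with $\hat\phi_{i,0}(\eta,\xi)=p_i(\xi)$ on $\hat K_F^-$. Then $B=\{\hat\phi_{i,j}\}_{i,j=0}^m$ is a basis of $\hat{\mathcal V}^m_{\hat\beta}(\hat K_F)$.
   Context: Geometry. $\Omega\subset\mathbb R^2$ is a rectangle divided by a simple connected curve $\Gamma$ into $\Omega^+$ and $\Omega^-$; $\beta$ equals the constant $\beta^\pm>0$ on $\Omega^\pm$. $m\ge1$ is an integer. $\mathbf g:[\xi_s,\xi_e]\to\Gamma$ is a $C^{3}$ parametrization of $\Gamma$ with $\mathbf g'\neq0$ everywhere. Set $\boldsymbol\tau=\mathbf g'/\|\mathbf g'\|$, $\mathbf n=Q\boldsymbol\tau$ with $Q=\begin{bmatrix}0&1\\-1&0\end{bmatrix}$, signed curvature $\kappa=\|\mathbf g'\|^{-3}(\mathbf g')^TQ\,\mathbf g''$, and $P_\Gamma(\eta,\xi)=\mathbf g(\xi)+\eta\,\mathbf n(\xi)$. It is assumed that for some $\epsilon>0$ the map $P_\Gamma:[-\epsilon,\epsilon]\times[\xi_s,\xi_e]\to N_\Gamma(\epsilon)$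 is a bijection onto its image with nonsingular Jacobian, that normal lines to $\Gamma$ at distinct points do not intersect inside $N_\Gamma(\epsilon)$, and that every point $A$ of $N_\Gamma(\epsilon)$ has a unique parameter $\xi_A$ with $\|A-\mathbf g(\xi_A)\|=\mathrm{dist}(\Gamma,A)$. Mesh. $\mathcal T_h$ is a uniform mesh of $\Omega$ by rectangles of diameter $h<\epsilon$. An interface element is $K\in\mathcal T_h$ whose interior meets $\Gamma$. If $\xi_1,\dots,\xi_4$ are the parameters $\xi_A$ of its four vertices, let $a_K=\min_i\xi_i$, $b_K=\max_i\xi_i$, $\hat K_F=[-h,h]\times[a_K,b_K]$, $\hat\Gamma_{K_F}=\{0\}\times[a_K,b_K]$, $\hat K_F^-=\hat K_F\cap\{\eta<0\}$, $\hat K_F^+=\hat K_F\cap\{\eta\ge0\}$; $\hat\beta=\beta^\pm$ on $\hat K_F^\pm$. For $v$ on $\hat K_F$, $v^\pm=v|_{\hat K_F^\pm}$ and $[[v]]=v^+|_{\eta=0}-v^-|_{\eta=0}$ on $\hat\Gamma_{K_F}$. Operator. With $\psi=(1+\eta\kappa(\xi))^{-1}$, $$\mathscr L(v)=v_{\eta\eta}+J_0v_{\xi\xi}+J_1v_\eta+J_2v_\xi,\quad J_0=\frac{\psi^2}{\|\mathbf g'\|^2},\quad J_1=\kappa\psi,\quad J_2=-\frac{\psi^2}{\|\mathbf g'\|^2}\Big(\eta\kappa'\psi+\frac{\mathbf g'\cdot\mathbf g''}{\|\mathbf g'\|^2}\Big).$$ Spaces. $Q^m(O)$: polynomials in $(\eta,\xi)$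 of degree $\le m$ in each variable, on $O$; $\mathcal P^m(\hat\Gamma_{K_F})$: polynomials in $\xi$ of degree $\le m$. $\hat{\mathcal V}^m_{\hat\beta}(\hat K_F)$ (also written $\hat{\mathcal V}^m_{\beta}(\hat K_F)$) is the set of $\hat\phi:\hat K_F\to\mathbb R$ with $\hat\phi|_{\hat K_F^\pm}\in Q^m(\hat K_F^\pm)$ such that for all $v\in\mathcal P^m(\hat\Gamma_{K_F})$ $$\int_{\hat\Gamma_{K_F}}[[\hat\phi]]v=0,\quad\int_{\hat\Gamma_{K_F}}[[\hat\beta\hat\phi_\eta]]v=0,\quad\int_{\hat\Gamma_{K_F}}\Big[\Big[\hat\beta\frac{\partial^j}{\partial\eta^j}\mathscr L(\hat\phi)\Big]\Big]v=0\ (0\le j\le m-2).$$ *)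

(* Defs.v *)
From HB Require Import structures.
From mathcomp Require Import all_boot all_order all_algebra.
From mathcomp Require Import all_classical all_reals all_analysis.
Set Implicit Arguments.
Unset Strict Implicit.
Unset Printing Implicit Defensive.
Import Order.TTheory GRing.Theory Num.Theory.
Import numFieldNormedType.Exports.
Local Open Scope classical_set_scope.
Local Open Scope ring_scope.

(* [R * R] carries the product topology, but its library norm is the maximum
   norm; [enorm] is the Euclidean one. *)
Definition enorm (R : realType) (v : R * R) : R :=
  Num.sqrt (v.1 ^+ 2 + v.2 ^+ 2).

Definition dotp (R : realType) (u v : R * R) : R := u.1 * v.1 + u.2 * v.2.

(* Multiplication by the matrix [0 1; -1 0]. *)
Definition rotQ (R : realType) (v : R * R) : R * R := (v.2, - v.1).

(* k-th derivative of a plane curve, componentwise. *)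
Definition curve_derive (R : realType) (k : nat) (g : R -> R * R) : R -> R * R :=
  fun x => (derive1n k (fun t => (g t).1) x, derive1n k (fun t => (g t).2) x).

(* f is C^n on a neighbourhood of [a, b].  A C^n function on [a, b] is the
   restriction of such a function, whose derivatives on [a, b] (one-sided ones
   at the endpoints) do not depend on the extension. *)
Definition Cn_on (R : realType) (n : nat) (a b : R) (f : R -> R) : Prop :=
  forall x, x \in `[a, b] -> \forall y \near x,
    (forall k, (k < n)%N -> derivable (derive1n k f) y 1) /\
    {for y, continuous (derive1n n f)}.

Definition curve_Cn_on (R : realType) (n : nat) (a b : R) (g : R -> R * R) : Prop :=
  Cn_on n a b (fun t => (g t).1) /\ Cn_on n a b (fun t => (g t).2).

Definition unit_tangent (R : realType) (g : R -> R * R) (x : R) : R * R :=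
  let d := curve_derive 1 g x in (d.1 / enorm d, d.2 / enorm d).

Definition unit_normal (R : realType) (g : R -> R * R) (x : R) : R * R :=
  rotQ (unit_tangent g x).

Definition curvature (R : realType) (g : R -> R * R) (x : R) : R :=
  enorm (curve_derive 1 g x) ^- 3
  * dotp (curve_derive 1 g x) (rotQ (curve_derive 2 g x)).

(* Points of the (eta, xi) plane are pairs with eta as first component. *)
Definition PGamma (R : realType) (g : R -> R * R) (z : R * R) : R * R :=
  ((g z.2).1 + z.1 * (unit_normal g z.2).1, (g z.2).2 + z.1 * (unit_normal g z.2).2).

Definition d_eta (R : realType) (v : R * R -> R) : R * R -> R :=
  fun z => derive1 (fun e => v (e, z.2)) z.1.

Definition d_xi (R : realType) (v : R * R -> R) : R * R -> R :=
  fun z => derive1 (fun x => v (z.1, x)) z.2.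

Definition jacobian_det (R : realType) (F : R * R -> R * R) (z : R * R) : R :=
  d_eta (fun w => (F w).1) z * d_xi (fun w => (F w).2) z
  - d_xi (fun w => (F w).1) z * d_eta (fun w => (F w).2) z.

Definition curve (R : realType) (g : R -> R * R) (xs xe : R) : set (R * R) :=
  g @` `[xs, xe].

Definition dist_curve (R : realType) (g : R -> R * R) (xs xe : R) (A : R * R) : R :=
  inf [set enorm (A - g t) | t in `[xs, xe]].

(* x is a parameter xi_A attached to the point A. *)
Definition nearest_param (R : realType) (g : R -> R * R) (xs xe : R)
    (A : R * R) (x : R) : Prop :=
  x \in `[xs, xe] /\ enorm (A - g x) = dist_curve g xs xe A.

Definition normal_line (R : realType) (g : R -> R * R) (x : R) : set (R * R) :=
  [set PGamma g (t, x) | t in setT].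

Definition tube_domain (R : realType) (xs xe eps : R) : set (R * R) :=
  `[- eps, eps] `*` `[xs, xe].

Definition tube (R : realType) (g : R -> R * R) (xs xe eps : R) : set (R * R) :=
  PGamma g @` tube_domain xs xe eps.

Definition regular_interface (R : realType) (g : R -> R * R) (xs xe : R) : Prop :=
  [/\ xs < xe,
      curve_Cn_on 3 xs xe g,
      forall x, x \in `[xs, xe] -> curve_derive 1 g x <> (0, 0) &
      {in `[xs, xe] &, injective g}].

Definition tubular_assumptions (R : realType) (g : R -> R * R)
    (xs xe eps : R) : Prop :=
  let N := tube g xs xe eps in
  [/\ 0 < eps,
      set_bij (tube_domain xs xe eps) N (PGamma g),
      forall z, tube_domain xs xe eps z -> jacobian_det (PGamma g) z <> 0,
      forall x1 x2, x1 \in `[xs, xe] -> x2 \in `[xs, xe] -> g x1 <> g x2 ->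
        normal_line g x1 `&` normal_line g x2 `&` N = set0 &
      forall A, N A -> exists! x, nearest_param g xs xe A x].

Definition open_rect (R : realType) (lo hi : R * R) : set (R * R) :=
  `]lo.1, hi.1[ `*` `]lo.2, hi.2[.

Definition closed_rect (R : realType) (lo hi : R * R) : set (R * R) :=
  `[lo.1, hi.1] `*` `[lo.2, hi.2].

(* The domain is the open rectangle; an interface with endpoints on the boundary
   is only contained in the closed one. *)
Definition divides (R : realType) (lo hi : R * R)
    (Gamma Omegap Omegam : set (R * R)) : Prop :=
  (lo.1 < hi.1 /\ lo.2 < hi.2) /\
  Gamma `<=` closed_rect lo hi /\
  [/\ open Omegap /\ open Omegam,
      connected Omegap /\ connected Omegam,
      Omegap !=set0 /\ Omegam !=set0,
      Omegap `&` Omegam = set0 &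
      open_rect lo hi `\` Gamma = Omegap `|` Omegam].

Definition piecewise_const (R : realType) (Omegap Omegam : set (R * R))
    (betap betam : R) (beta : R * R -> R) : Prop :=
  [/\ 0 < betap, 0 < betam,
      forall A, Omegap A -> beta A = betap &
      forall A, Omegam A -> beta A = betam].

Definition mesh_step (R : realType) (lo hi : R * R) (nx ny : nat) : R * R :=
  ((hi.1 - lo.1) / nx%:R, (hi.2 - lo.2) / ny%:R).

Definition mesh_node (R : realType) (lo hi : R * R) (nx ny : nat)
    (k l : nat) : R * R :=
  (lo.1 + k%:R * (mesh_step lo hi nx ny).1,
   lo.2 + l%:R * (mesh_step lo hi nx ny).2).

(* Cell (k, l), for k < nx and l < ny, of the uniform nx-by-ny mesh. *)
Definition mesh_cell (R : realType) (lo hi : R * R) (nx ny : nat)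
    (k l : nat) : set (R * R) :=
  closed_rect (mesh_node lo hi nx ny k l) (mesh_node lo hi nx ny k.+1 l.+1).

Definition cell_vertex (R : realType) (lo hi : R * R) (nx ny : nat)
    (k l : nat) (s : bool * bool) : R * R :=
  mesh_node lo hi nx ny (k + s.1) (l + s.2).

Definition interface_element (R : realType) (Gamma K : set (R * R)) : Prop :=
  interior K `&` Gamma !=set0.

Definition fict_elt (R : realType) (h a b : R) : set (R * R) :=
  `[- h, h] `*` `[a, b].

Definition fict_elt_minus (R : realType) (h a b : R) : set (R * R) :=
  fict_elt h a b `&` [set z | z.1 < 0].

Definition fict_elt_plus (R : realType) (h a b : R) : set (R * R) :=
  fict_elt h a b `&` [set z | 0 <= z.1].

Definition beta_hat (R : realType) (betap betam : R) (z : R * R) : R :=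
  if z.1 < 0 then betam else betap.

Definition psi (R : realType) (g : R -> R * R) (z : R * R) : R :=
  (1 + z.1 * curvature g z.2)^-1.

Definition J0 (R : realType) (g : R -> R * R) (z : R * R) : R :=
  psi g z ^+ 2 / enorm (curve_derive 1 g z.2) ^+ 2.

Definition J1 (R : realType) (g : R -> R * R) (z : R * R) : R :=
  curvature g z.2 * psi g z.

Definition J2 (R : realType) (g : R -> R * R) (z : R * R) : R :=
  - (psi g z ^+ 2 / enorm (curve_derive 1 g z.2) ^+ 2)
  * (z.1 * derive1 (curvature g) z.2 * psi g z
     + dotp (curve_derive 1 g z.2) (curve_derive 2 g z.2)
       / enorm (curve_derive 1 g z.2) ^+ 2).

Definition opL (R : realType) (g : R -> R * R) (v : R * R -> R) : R * R -> R :=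
  fun z => d_eta (d_eta v) z + J0 g z * d_xi (d_xi v) z
           + J1 g z * d_eta v z + J2 g z * d_xi v z.

(* Functions on a set D are represented by total functions of which only the
   values on D matter. *)
Definition basis_on (R : realType) (T : Type) (D : set T) (S : set (T -> R))
    (I : finType) (b : I -> T -> R) : Prop :=
  [/\ forall i, S (b i),
      forall c : I -> R,
        (forall z, D z -> \sum_i c i * b i z = 0) -> forall i, c i = 0 &
      forall f, S f ->
        exists c : I -> R, forall z, D z -> f z = \sum_i c i * b i z].

(* P^m on {0} x [a, b], as functions of xi. *)
Definition poly_space (R : realType) (m : nat) (a b : R) : set (R -> R) :=
  [set v | exists q : {poly R},
    (size q <= m.+1)%N /\ forall x, x \in `[a, b] -> v x = q.[x]].

(* The polynomial in (eta, xi) with coefficient matrix C. *)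
Definition evalQ (R : realType) (m : nat) (C : 'M[R]_m.+1) : R * R -> R :=
  fun z => \sum_(k < m.+1) \sum_(l < m.+1) C k l * z.1 ^+ k * z.2 ^+ l.

Definition jump (R : realType) (wp wm : R * R -> R) (x : R) : R :=
  wp (0, x) - wm (0, x).

Definition jump_orthogonal (R : realType) (m : nat) (a b : R)
    (wp wm : R * R -> R) : Prop :=
  forall v, poly_space m a b v ->
    \int[lebesgue_measure]_(x in `[a, b]) (jump wp wm x * v x) = 0.

(* The pieces of phi are restrictions of polynomials; their one-sided
   eta-derivatives and traces at eta = 0 are those of the polynomials. *)
Definition ife_space (R : realType) (g : R -> R * R) (betap betam : R)
    (m : nat) (h a b : R) : set (R * R -> R) :=
  [set phi | exists Cp Cm : 'M[R]_m.+1,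
    let phip := evalQ Cp in
    let phim := evalQ Cm in
    [/\ (forall z, fict_elt_plus h a b z -> phi z = phip z) /\
        (forall z, fict_elt_minus h a b z -> phi z = phim z),
        jump_orthogonal m a b phip phim,
        jump_orthogonal m a b (fun z => betap * d_eta phip z)
                              (fun z => betam * d_eta phim z) &
        forall j, (j + 2 <= m)%N ->
          jump_orthogonal m a b
            (fun z => betap * iter j (@d_eta R) (opL g phip) z)
            (fun z => betam * iter j (@d_eta R) (opL g phim) z)]].

(* phi belongs to the IFE space and equals p(xi) on the minus side. *)
Definition ife_extension (R : realType) (g : R -> R * R) (betap betam : R)
    (m : nat) (h a b : R) (p : R -> R) (phi : R * R -> R) : Prop :=
  ife_space g betap betam m h a b phi /\
  forall z, fict_elt_minus h a b z -> phi z = p z.2.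

Definition ife_family (R : realType) (betap betam : R) (m : nat)
    (p : 'I_m.+1 -> R -> R) (phi0 : 'I_m.+1 -> R * R -> R)
    (ij : 'I_m.+1 * 'I_m.+1) : R * R -> R :=
  if ij.2 == ord0 then phi0 ij.1
  else fun z => (beta_hat betap betam z)^-1 * z.1 ^+ ij.2 * p ij.1 z.2.

(* Main.v *)
Require Import Defs.
From HB Require Import structures.
From mathcomp Require Import all_boot all_order all_algebra.
From mathcomp Require Import all_classical all_reals all_analysis.
From mathcomp Require Import zify ring lra.
Import Order.TTheory GRing.Theory Num.Theory.
Import numFieldNormedType.Exports.
Local Open Scope classical_set_scope.
Local Open Scope ring_scope.

(** At fixed xi, L of a polynomial is, as a function of eta near 0, a polynomial
    divided by (1 + eta kappa)^3, so the jump conditions only involve traces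
    t_0, ..., t_m at eta = 0 that are linear in the coefficient matrix and
    continuous in xi.  If the first n powers of eta are absent from a polynomial,
    its t_n is n! times the coefficient of eta^n; hence the map M sending a
    coefficient matrix to the moments of its traces against 1, xi, ..., xi^m on
    [a, b] is injective, and so bijective by dimension.  The conditions read
    w_n^+ M(C^+) = w_n^- M(C^-) row by row, with nonzero weights, so the
    restriction to the minus side can be any element of Q^m and determines the
    function.  The family is a basis because its restriction to the minus side
    is one, up to factors.  That a < b is forced by the hypothesis that p is a
    basis of m + 1 >= 2 functions on [a, b]. *)

(** * Roots and lowest coefficients of univariate polynomials *)

(** A nonzero [q] would have [size q] distinct roots in the interval, more than its degree. *)
Lemma poly_vanish_itv {R : realFieldType} (q : {poly R}) (c d : R) :
  c < d -> (forall x, c < x < d -> q.[x] = 0) -> q = 0.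
Proof.
move=> cd q0; apply/eqP; apply: contraT => qN0.
pose n := size q.
(* Equally spaced points; the successors in numerator and denominator keep them off both endpoints
   for [i < n]. *)
pose pt (i : nat) := c + (d - c) * (i.+1%:R / n.+1%:R).
have ptP i : (i < n)%N -> c < pt i < d.
  move=> ilt; have t0 : 0 < i.+1%:R / n.+1%:R :> R by rewrite divr_gt0 ?ltr0n.
  have t1 : i.+1%:R / n.+1%:R < 1 :> R.
    by rewrite ltr_pdivrMr ?ltr0n// mul1r ltr_nat ltnS.
  by rewrite /pt; move: t0 t1 cd; set t := _ / _; nra.
have pt_inj : injective pt.
  move=> i j /addrI /mulfI; rewrite subr_eq0 gt_eqF// => /(_ isT).
  have Nn : (n.+1%:R : R)^-1 != 0 by rewrite invr_eq0 pnatr_eq0.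
  by move=> /(mulIf Nn) /eqP; rewrite eqr_nat => /eqP [].
suff: (size [seq pt i | i <- iota 0 n] < size q)%N.
  by rewrite size_map size_iota ltnn.
apply: max_poly_roots => //; last by rewrite map_inj_uniq ?iota_uniq.
by apply/allP => _ /mapP[i + ->]; rewrite mem_iota => /ptP /q0/rootP.
Qed.

(** In the convolution every term but the last contains a vanishing coefficient of [P]. A cofactor
    thus affects the lowest order only through its constant term. *)
Lemma coef_mul_low {R : nzRingType} (P Q : {poly R}) (n : nat) :
  (forall k, (k < n)%N -> P`_k = 0) ->
  (forall k, (k < n)%N -> (P * Q)`_k = 0) /\ (P * Q)`_n = P`_n * Q`_0.
Proof.
move=> P0; split=> [k kn|].
  rewrite coefM big1// => i _.
  by rewrite P0 ?mul0r// (leq_ltn_trans _ kn)// -ltnS ltn_ord.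
rewrite coefM big_ord_recr /= subnn big1 ?add0r// => i _.
by rewrite P0 ?mul0r.
Qed.

(** * Polynomials in eta and xi, and their partial derivatives *)

Section BivariatePolynomials.
Context {R : realType}.
Implicit Types (S : {poly {poly R}}) (P : {poly R}) (x e : R).

(* The outer variable of [S] is eta, the inner one xi. *)
Definition slice x S : {poly R} := map_poly (horner_eval x) S.

(** Evaluating xi first leaves a polynomial in eta, which is what gets divided by powers of 1 + eta
    kappa. *)
Definition bipoly S : R * R -> R := fun z => (slice z.2 S).[z.1].

Lemma coef_slice x S k : (slice x S)`_k = (S`_k).[x].
Proof. by rewrite coef_map. Qed.

Lemma slice_linear x c S S' :
  slice x (c%:P *: S + S') = c *: slice x S + slice x S'.
Proof. by apply/polyP => k; rewrite !(coefD, coefZ, coef_slice) !hornerE. Qed.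

Lemma deriv_slice x S : (slice x S)^`() = slice x S^`().
Proof. by rewrite /slice deriv_map. Qed.

Definition deriv_inner S : {poly {poly R}} := map_poly (@deriv R) S.

Lemma coef_deriv_inner S k : (deriv_inner S)`_k = (S`_k)^`().
Proof. by rewrite coef_map_id0 ?deriv0. Qed.

(** The opposite order of evaluation, suited to differentiation in xi. *)
Lemma bipolyE S z : bipoly S z = S.[z.1%:P].[z.2].
Proof.
rewrite /bipoly /slice -[z.1 in LHS](_ : horner_eval z.2 (z.1)%:P = _).
  by rewrite horner_map.
by rewrite /horner_eval hornerC.
Qed.

Lemma deriv_horner_polyC S e : (S.[e%:P])^`() = (deriv_inner S).[e%:P].
Proof.
elim/poly_ind: S => [|S c IH].
  by rewrite /deriv_inner map_poly0 !horner0 deriv0.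
have -> : deriv_inner (S * 'X + c%:P) = deriv_inner S * 'X + (c^`())%:P.
  apply/polyP => k; rewrite coef_deriv_inner !coefD !coefMX !coefC derivD.
  by case: k => [|k] /=; rewrite ?deriv0// coef_deriv_inner.
by rewrite !hornerE derivD derivM derivC mulr0 addr0 IH.
Qed.

Lemma d_eta_bipoly S : d_eta (bipoly S) = bipoly S^`().
Proof.
apply/funext => z; rewrite /d_eta /bipoly /=.
by rewrite -deriv_slice derivE.
Qed.

Lemma d_xi_bipoly S : d_xi (bipoly S) = bipoly (deriv_inner S).
Proof.
apply/funext => z; rewrite [RHS]bipolyE -deriv_horner_polyC derivE.
rewrite /d_xi (_ : (fun x => bipoly S (z.1, x)) = horner S.[(z.1)%:P])//.
by apply/funext => x; rewrite bipolyE.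
Qed.

End BivariatePolynomials.

(** * Iterated derivatives of a polynomial over a power of 1 + eta kappa *)

Section IteratedDerivative.
Context {R : realType}.
Variable kap : R.
Implicit Types P : {poly R}.

Let u : {poly R} := 1 + kap *: 'X.

(* The numerators of the derivatives of [P / u ^ n]: the j-th derivative is
   [deriv_num n j P / u ^ (n + j)]. *)
Fixpoint deriv_num (n j : nat) P : {poly R} :=
  if j is j'.+1 then
    let P' := deriv_num n j' P in P'^`() * u - ((n + j')%:R * kap) *: P'
  else P.

Lemma deriv_num_linear n j c P Q :
  deriv_num n j (c *: P + Q) = c *: deriv_num n j P + deriv_num n j Q.
Proof.
elim: j => //= j ->; rewrite derivD derivZ -!mul_polyC; ring.
Qed.

(** As [u] has constant term 1 and the subtracted multiple of [P'] starts one degree above its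
    derivative, each step acts on the lowest coefficient like plain differentiation; hence the
    falling factorial. *)
Lemma coef_deriv_num_low n j P N :
  (forall k, (k < N + j)%N -> P`_k = 0) ->
  (forall k, (k < N)%N -> (deriv_num n j P)`_k = 0) /\
  (deriv_num n j P)`_N = P`_(N + j) *+ ((N + j) ^_ j)%N.
Proof.
elim: j N => [|j IH] N P0.
  by rewrite ffactn0 addn0; split=> // k; rewrite -{1}(addn0 N) => /P0.
have [|IH1 IH2] := IH N.+1; first by move=> k; rewrite addSnnS => /P0.
set P' := deriv_num n j P in IH1 IH2 *.
have dP0 k : (k < N)%N -> (P'^`())`_k = 0.
  by move=> kN; rewrite coef_deriv IH1 ?mul0rn.
have [H1 H2] := coef_mul_low P'^`() u N dP0.
have u0 : u`_0 = 1 by rewrite coefD coefZ coefX coef1 mulr0 addr0.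
split=> [k kN|] /=.
  by rewrite coefB coefZ H1// IH1 ?ltnS 1?ltnW// mulr0 subrr.
rewrite coefB coefZ H2 IH1 ?leqnn// mulr0 subr0 u0 mulr1 coef_deriv IH2.
by rewrite -mulrnA addSnnS ffactnSr -addSnnS addnK.
Qed.

Lemma derive1n_rational (f : R -> R) P (n j : nat) :
  (forall e, u.[e] != 0 -> f e = P.[e] / u.[e] ^+ n) ->
  forall e, u.[e] != 0 ->
    derive1n j f e = (deriv_num n j P).[e] / u.[e] ^+ (n + j).
Proof.
move=> fE; elim: j => [|j IH] e ue; first by rewrite addn0; exact: fE.
rewrite derive1nS derive1E.
set Q := deriv_num n j P in IH *.
(* Nonvanishing of [u] is an open condition, so the induction hypothesis holds near [e] and may be
   differentiated. *)
have near_u : \forall y \near e, u.[y] != 0.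
  exact: (cvgr_neq0 _ (@continuous_horner _ u e) ue).
rewrite (@near_eq_derive _ _ _ _ (horner Q * (fun y => (u ^+ (n + j)).[y]^-1)));
  last by near=> y; rewrite !fctE horner_exp; apply: IH; near: y.
have uN0 : (u ^+ (n + j)).[e] != 0 by rewrite horner_exp expf_neq0.
have dV := is_deriveV uN0 (is_derive_poly _ e).
have dQ := is_deriveM (is_derive_poly Q e) dV.
have du : u^`() = kap%:P.
  by rewrite derivD derivZ derivX derivC add0r -mul_polyC mulr1.
have -> : 'D_1 (horner Q * (fun y => (u ^+ (n + j)).[y]^-1)) e =
    Q.[e] * (- (u.[e] ^+ (n + j)) ^- 2
             * (kap * u.[e] ^+ (n + j).-1 *+ (n + j)))
    + (u.[e] ^+ (n + j))^-1 * Q^`().[e].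
  rewrite -[in RHS]horner_exp (derive_val (is_derive := dQ)).
  by rewrite deriv_exp du hornerMn hornerM hornerC horner_exp.
rewrite /= -/Q (hornerD (_ * _)) hornerN hornerM hornerZ addnS.
(* Exponent 0 is separate because the power rule produces the predecessor of the exponent. *)
case: (n + j)%N => [|N]; first by rewrite !expr0 expr1; field.
have uN : u.[e] ^+ N != 0 by rewrite expf_neq0.
by rewrite !exprS -mulr_natl; field; rewrite uN ue.
Unshelve. all: by end_near. Qed.

End IteratedDerivative.

(** * Continuity in xi of the coefficients of polynomials in eta *)

(** Coefficientwise continuity suffices: a trace is a single coefficient, and products and
    derivatives combine coefficients by finite sums. *)
Definition ccoef {R : realType} (x : R) (F : R -> {poly R}) :=
  forall i, {for x, continuous (fun y => (F y)`_i)}.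

Section CoefficientwiseContinuity.
Context {R : realType}.
Variable x : R.
Implicit Types F G : R -> {poly R}.

Lemma ccoefD F G : ccoef x F -> ccoef x G -> ccoef x (fun y => F y + G y).
Proof.
move=> cF cG i; rewrite (_ : (fun y => _) = (fun y => (F y)`_i + (G y)`_i)).
  exact: cvgD (cF i) (cG i).
by apply/funext => y; rewrite coefD.
Qed.

Lemma ccoefN F : ccoef x F -> ccoef x (fun y => - F y).
Proof.
move=> cF i; rewrite (_ : (fun y => _) = (fun y => - (F y)`_i)).
  exact: cvgN (cF i).
by apply/funext => y; rewrite coefN.
Qed.

Lemma ccoefM F G : ccoef x F -> ccoef x G -> ccoef x (fun y => F y * G y).
Proof.
move=> cF cG i.
rewrite (_ : (fun y => _) =
             (fun y => \sum_(k < i.+1) (F y)`_k * (G y)`_(i - k))); last first.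
  by apply/funext => y; rewrite coefM.
apply: cvg_big => [|k _]; first exact: add_continuous.
exact: cvgM (cF k) (cG _).
Qed.

Lemma ccoef_cst (P : {poly R}) : ccoef x (fun=> P).
Proof. by move=> i; exact: cvg_cst. Qed.

Lemma ccoefC (f : R -> R) :
  {for x, continuous f} -> ccoef x (fun y => (f y)%:P).
Proof.
move=> cf i.
rewrite (_ : (fun y => _) = (fun y => if i == 0%N then f y else 0)).
  by case: (i == 0)%N => //; exact: cvg_cst.
by apply/funext => y; rewrite coefC.
Qed.

Lemma ccoefZ (f : R -> R) F :
  {for x, continuous f} -> ccoef x F -> ccoef x (fun y => f y *: F y).
Proof.
move=> cf cF; rewrite (_ : (fun y => _) = (fun y => (f y)%:P * F y)).
  by apply: ccoefM => //; exact: ccoefC.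
by apply/funext => y; rewrite mul_polyC.
Qed.

Lemma ccoefX F n : ccoef x F -> ccoef x (fun y => F y ^+ n).
Proof.
move=> cF; elim: n => [|n IH]; first exact: ccoef_cst.
rewrite (_ : (fun y => _) = (fun y => F y * F y ^+ n)); first exact: ccoefM.
by apply/funext => y; rewrite exprS.
Qed.

Lemma ccoef_deriv F : ccoef x F -> ccoef x (fun y => (F y)^`()).
Proof.
move=> cF i; rewrite (_ : (fun y => _) = (fun y => i.+1%:R * (F y)`_i.+1)).
  exact: cvgM (cvg_cst _) (cF _).
by apply/funext => y; rewrite coef_deriv mulr_natl.
Qed.

Lemma ccoef_slice (S : {poly {poly R}}) : ccoef x (fun y => slice y S).
Proof.
move=> i; rewrite (_ : (fun y => _) = horner S`_i).
  exact: continuous_horner.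
by apply/funext => y; rewrite coef_slice.
Qed.

Lemma ccoef_deriv_num (kap : R -> R) F n j :
  {for x, continuous kap} -> ccoef x F ->
  ccoef x (fun y => deriv_num (kap y) n j (F y)).
Proof.
move=> ck cF; elim: j => [//|j IH] /=.
apply: ccoefD.
  apply: ccoefM; first exact: ccoef_deriv.
  by apply: ccoefD; [exact: ccoef_cst|apply: ccoefZ => //; exact: ccoef_cst].
by apply/ccoefN/ccoefZ => //; exact: cvgM (cvg_cst _) ck.
Qed.

End CoefficientwiseContinuity.

(** * Traces at eta = 0 *)

Section Traces.
Context {R : realType}.
Variable g : R -> R * R.
Implicit Types (S : {poly {poly R}}) (x e : R).

(** The reciprocal of [psi] at fixed xi. *)
Let u x : {poly R} := 1 + curvature g x *: 'X.

Let w x := (enorm (curve_derive 1 g x) ^+ 2)^-1.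

Let dd x := dotp (curve_derive 1 g x) (curve_derive 2 g x).

Let uE x e : (u x).[e] = 1 + curvature g x * e.
Proof. by rewrite hornerD hornerZ hornerX (hornerC 1). Qed.

(* The denominators in [opL] are powers of [u x]; [opL_num S x] is
   [u x ^ 3 * L (bipoly S)] at fixed x, a polynomial in eta. *)
Definition opL_num S x : {poly R} :=
  slice x S^`()^`() * u x ^+ 3
  + slice x (deriv_inner (deriv_inner S)) * ((w x)%:P * u x)
  + slice x S^`() * ((curvature g x)%:P * u x ^+ 2)
  - slice x (deriv_inner S)
    * ((w x)%:P * ((derive1 (curvature g) x) *: 'X + (dd x * w x)%:P * u x)).

Lemma opL_bipoly S x e : (u x).[e] != 0 ->
  opL g (bipoly S) (e, x) = (opL_num S x).[e] / (u x).[e] ^+ 3.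
Proof.
rewrite /opL !d_xi_bipoly !d_eta_bipoly /J0 /J1 /J2 /psi /bipoly /=.
rewrite -/(w x) -/(dd x) [1 + e * _](_ : _ = (u x).[e]); last first.
  by rewrite uE [e * _]mulrC.
rewrite /opL_num.
set U := u x.
rewrite !(hornerD, hornerN, hornerM, hornerC, hornerZ, hornerX, horner_exp).
by move=> U0; field.
Qed.

Lemma iter_d_eta (f : R * R -> R) j e x :
  iter j (@d_eta R) f (e, x) = derive1n j (fun t => f (t, x)) e.
Proof.
elim: j e => [//|j IH] e; rewrite derive1nS iterS {1}/d_eta /=.
by congr (derive1 _ e); apply/funext => t; exact: IH.
Qed.

(* [trace n S x] is the function whose jump is tested by the n-th condition of
   [ife_space]: the value, the eta-derivative, and then the eta-derivatives of
   L of [bipoly S] at (0, x). *)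
Definition trace n S x : R :=
  match n with
  | 0 => (S`_0).[x]
  | 1 => (S`_1).[x]
  | j.+2 => (deriv_num (curvature g x) 3 j (opL_num S x))`_0
  end.

Lemma trace0E S x : bipoly S (0, x) = trace 0 S x.
Proof. by rewrite /bipoly horner_coef0 coef_slice. Qed.

Lemma trace1E S x : d_eta (bipoly S) (0, x) = trace 1 S x.
Proof.
by rewrite d_eta_bipoly /bipoly horner_coef0 coef_slice coef_deriv mulr1n.
Qed.

(** The denominator [u x] equals 1 at eta = 0, so only the constant coefficient of the numerator
    remains. *)
Lemma trace2E S x j :
  iter j (@d_eta R) (opL g (bipoly S)) (0, x) = trace j.+2 S x.
Proof.
have u0 : (u x).[0] = 1 by rewrite uE mulr0 addr0.
have uN0 : (u x).[0] != 0 by rewrite u0 oner_neq0.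
rewrite iter_d_eta (@derive1n_rational _ (curvature g x) _ (opL_num S x) 3)//.
  by rewrite -/(u x) u0 expr1n divr1 horner_coef0.
by move=> e; exact: opL_bipoly.
Qed.

Lemma opL_num_linear c S S' x :
  opL_num (c%:P *: S + S') x = c *: opL_num S x + opL_num S' x.
Proof.
have dl T T' :
    deriv_inner (c%:P *: T + T') = c%:P *: deriv_inner T + deriv_inner T'.
  apply/polyP => k; rewrite !(coefD, coefZ, coef_deriv_inner).
  by rewrite derivD derivM derivC mul0r add0r.
have dZ T T' : (c%:P *: T + T')^`() = c%:P *: T^`() + T'^`().
  by rewrite derivD derivZ.
rewrite /opL_num !dZ !dl !slice_linear -!mul_polyC; ring.
Qed.

Lemma trace_linear n c S S' x :
  trace n (c%:P *: S + S') x = c * trace n S x + trace n S' x.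
Proof.
case: n => [|[|j]] /=; rewrite ?coefD ?coefZ ?hornerE//.
by rewrite opL_num_linear deriv_num_linear coefD coefZ.
Qed.

(** For [n = j + 2] only the second eta-derivative in [opL_num] reaches order [j]; the other
    summands start later. It contributes the factor (j+2)(j+1), and the [j] further derivatives
    contribute j!. This makes the traces triangular in the powers of eta. *)
Lemma trace_low n S x : (forall k, (k < n)%N -> S`_k = 0) ->
  trace n S x = (S`_n).[x] *+ n`!.
Proof.
case: n => [|[|j]] S0 //.
have s0 (T : {poly {poly R}}) N : (forall k, (k < N)%N -> T`_k = 0) ->
    forall k, (k < N)%N -> (slice x T)`_k = 0.
  by move=> T0 k kN; rewrite coef_slice T0 ?horner0.
have S0d k : (k < j.+1)%N -> (S^`())`_k = 0.
  by move=> kj; rewrite coef_deriv S0 ?mul0rn.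
have S0dd k : (k < j)%N -> (S^`()^`())`_k = 0.
  by move=> kj; rewrite coef_deriv S0d ?mul0rn.
have S0i k : (k < j.+2)%N -> (deriv_inner S)`_k = 0.
  by move=> kj; rewrite coef_deriv_inner S0 ?deriv0.
have S0ii k : (k < j.+2)%N -> (deriv_inner (deriv_inner S))`_k = 0.
  by move=> kj; rewrite coef_deriv_inner S0i ?deriv0.
have [A1 A2] := coef_mul_low (slice x S^`()^`()) (u x ^+ 3) j (s0 _ _ S0dd).
have [B1 _] := coef_mul_low (slice x (deriv_inner (deriv_inner S)))
  ((w x)%:P * u x) j.+2 (s0 _ _ S0ii).
have [C1 _] := coef_mul_low (slice x S^`())
  ((curvature g x)%:P * u x ^+ 2) j.+1 (s0 _ _ S0d).
have [D1 _] := coef_mul_low (slice x (deriv_inner S))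
  ((w x)%:P * ((derive1 (curvature g) x) *: 'X + (dd x * w x)%:P * u x))
  j.+2 (s0 _ _ S0i).
have N0 k : (k < j)%N -> (opL_num S x)`_k = 0.
  move=> kj; have kj1 := leqW kj; have kj2 := leqW kj1.
  by rewrite coefB !coefD A1// B1// C1// D1// !addr0 subr0.
have Nj : (opL_num S x)`_j = (S`_j.+2).[x] *+ (j.+2 * j.+1).
  have jj : (j < j.+2)%N by exact: leqW.
  rewrite coefB !coefD A2 B1// C1// D1// !addr0 subr0.
  rewrite coef_slice !coef_deriv -mulrnA hornerMn.
  by rewrite -horner_coef0 horner_exp uE mulr0 addr0 expr1n mulr1.
have [_ /=] := coef_deriv_num_low (curvature g x) 3 j (opL_num S x) 0 N0.
rewrite add0n ffactnn Nj -mulrnA => ->.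
by rewrite -mulnA -!factS.
Qed.

Lemma continuous_trace n S x :
  {for x, continuous (curvature g)} ->
  {for x, continuous (derive1 (curvature g))} ->
  {for x, continuous w} -> {for x, continuous dd} ->
  {for x, continuous (trace n S)}.
Proof.
move=> ck ck' cw cd.
case: n => [|[|j]]; [exact: continuous_horner|exact: continuous_horner|].
have cu : ccoef x u.
  by apply: ccoefD; [exact: ccoef_cst|apply: ccoefZ => //; exact: ccoef_cst].
suff cN : ccoef x (opL_num S) by exact: (ccoef_deriv_num _ _ _ _ _ ck cN).
apply: ccoefD; [apply: ccoefD; [apply: ccoefD|]|apply: ccoefN].
- by apply: ccoefM; [exact: ccoef_slice|exact: ccoefX].
- apply: ccoefM; first exact: ccoef_slice.
  by apply: ccoefM => //; exact: ccoefC.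
- apply: ccoefM; first exact: ccoef_slice.
  by apply: ccoefM; [exact: ccoefC|exact: ccoefX].
- apply: ccoefM; first exact: ccoef_slice.
  apply: ccoefM; first exact: ccoefC.
  apply: ccoefD; first by apply: ccoefZ => //; exact: ccoef_cst.
  by apply: ccoefM => //; apply: ccoefC; exact: cvgM.
Qed.

End Traces.

(** * Continuity of the geometric coefficients of L *)

Lemma Cn_on_is_derive {R : realType} (n : nat) (a b : R) (f : R -> R) (x : R) :
  Cn_on n a b f -> x \in `[a, b] -> \forall y \near x,
    forall k, (k < n)%N -> is_derive (y : R) 1 (derive1n k f) (derive1n k.+1 f y).
Proof.
move=> fn xab; apply: filterS (fn _ xab) => y [df _] k kn.
by apply: DeriveDef; [exact: df|rewrite derive1nS derive1E].
Qed.

Lemma Cn_on_continuous {R : realType} (n : nat) (a b : R) (f : R -> R) (x : R) k :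
  Cn_on n a b f -> x \in `[a, b] -> (k <= n)%N ->
  {for x, continuous (derive1n k f)}.
Proof.
move=> fn xab kn; have [df cf] := nbhs_singleton (fn _ xab).
move: kn; rewrite leq_eqVlt => /predU1P[->//|kn].
exact/differentiable_continuous/derivable1_diffP/df.
Qed.

Section RegularityOfTheCoefficients.
Context {R : realType}.
Variables (g : R -> R * R) (xs xe x : R).
Hypothesis greg : regular_interface g xs xe.
Hypothesis xin : x \in `[xs, xe].

Let g1 k := derive1n k (fun t => (g t).1).
Let g2 k := derive1n k (fun t => (g t).2).

Let speed2 y := g1 1 y * g1 1 y + g2 1 y * g2 1 y.
Let area y := g1 1 y * g2 2 y - g2 1 y * g1 2 y.

Let cg1 k : (k <= 3)%N -> {for x, continuous (g1 k)}.
Proof. by case: greg => _ [c1 c2] _ _; exact: Cn_on_continuous c1 xin. Qed.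

Let cg2 k : (k <= 3)%N -> {for x, continuous (g2 k)}.
Proof. by case: greg => _ [c1 c2] _ _; exact: Cn_on_continuous c2 xin. Qed.

Let cspeed2 : {for x, continuous speed2}.
Proof. by apply: cvgD; apply: cvgM; (exact: cg1 || exact: cg2). Qed.

Let carea : {for x, continuous area}.
Proof. by apply: cvgB; apply: cvgM; (exact: cg1 || exact: cg2). Qed.

Let speed2_ge0 y : 0 <= speed2 y.
Proof. by rewrite addr_ge0// -expr2 sqr_ge0. Qed.

Let speed2_neq0 : speed2 x != 0.
Proof.
case: greg => _ _ gN0 _; apply/eqP => /eqP.
rewrite /speed2 -!expr2 paddr_eq0 ?sqr_ge0// !sqrf_eq0 => /andP[/eqP e1 /eqP e2].
by apply: (gN0 x xin); congr pair; [exact: e1|exact: e2].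
Qed.

Let speed2_near : \forall y \near x, 0 < speed2 y.
Proof.
apply: filterS (cvgr_neq0 _ cspeed2 speed2_neq0) => y y0.
by rewrite lt_neqAle eq_sym y0 speed2_ge0.
Qed.

Let speedE y : enorm (curve_derive 1 g y) = Num.sqrt (speed2 y).
Proof. by rewrite /enorm !expr2. Qed.

Let curvatureE : curvature g = area * (fun y => (Num.sqrt (speed2 y) ^+ 3)^-1).
Proof.
apply/funext => y; rewrite fctE /curvature speedE mulrC /dotp /rotQ /=.
by rewrite mulrN.
Qed.

Let sqrt_speed_neq0 y : speed2 y != 0 -> Num.sqrt (speed2 y) != 0.
Proof. by move=> s0; rewrite sqrtr_eq0 -ltNge lt_neqAle eq_sym s0 speed2_ge0. Qed.

Let csqrt : {for x, continuous (fun y => Num.sqrt (speed2 y))}.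
Proof. exact: (continuous_comp cspeed2 (@sqrt_continuous _ _)). Qed.

Let csqrtX n : {for x, continuous (fun y => (Num.sqrt (speed2 y) ^+ n))}.
Proof. exact: (continuous_comp csqrt (@exprn_continuous _ _ _)). Qed.

Lemma continuous_curvature : {for x, continuous (curvature g)}.
Proof.
rewrite curvatureE; apply: cvgM; first exact: carea.
by apply: cvgV; [rewrite expf_neq0// sqrt_speed_neq0|exact: csqrtX].
Qed.

Lemma continuous_inv_speed2 :
  {for x, continuous (fun y => (enorm (curve_derive 1 g y) ^+ 2)^-1)}.
Proof.
rewrite (_ : (fun y => _) = (fun y => (speed2 y)^-1)); first exact: cvgV.
by apply/funext => y; rewrite speedE sqr_sqrtr.
Qed.

Lemma continuous_dot12 :
  {for x, continuous (fun y => dotp (curve_derive 1 g y) (curve_derive 2 g y))}.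
Proof. by apply: cvgD; apply: cvgM; (exact: cg1 || exact: cg2). Qed.

(** The curvature contains second derivatives of [g], so its derivative contains third ones,
    continuous because [g] is C^3. Near [x] the speed is positive and the derivative has the
    explicit form [K]. *)
Lemma continuous_derive_curvature : {for x, continuous (derive1 (curvature g))}.
Proof.
pose s y := Num.sqrt (speed2 y).
pose s' y := (2 * s y)^-1 * (g1 1 y * g1 2 y + g1 1 y * g1 2 y +
                             (g2 1 y * g2 2 y + g2 1 y * g2 2 y)).
(* The products of second derivatives cancel, but are kept in the shape given by the product
   rule. *)
pose area' y := g1 1 y * g2 3 y + g2 2 y * g1 2 y
                - (g2 1 y * g1 3 y + g1 2 y * g2 2 y).
pose K y := area y * (- (s y ^+ 3) ^- 2 * (3 * s y ^+ 2 * s' y))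
            + (s y ^+ 3)^-1 * area' y.
(* Equality on a whole neighbourhood is required to transfer continuity at [x]. *)
have KE : \forall y \near x, K y = derive1 (curvature g) y.
  case: greg => _ [c1 c2] _ _.
  have d1 := Cn_on_is_derive _ _ _ _ _ c1 xin.
  have d2 := Cn_on_is_derive _ _ _ _ _ c2 xin.
  apply: filterS3 speed2_near d1 d2 => y s0 e1 e2.
  have ds2 : is_derive y 1 speed2 _ :=
    is_deriveD (is_deriveM (e1 1%N isT) (e1 1%N isT))
               (is_deriveM (e2 1%N isT) (e2 1%N isT)).
  have da : is_derive y 1 area _ :=
    is_deriveB (is_deriveM (e1 1%N isT) (e2 2%N isT))
               (is_deriveM (e2 1%N isT) (e1 2%N isT)).
  have ds : is_derive y 1 s _ := is_derive1_comp (is_derive1_sqrt s0) ds2.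
  have ds3 := is_deriveX 3 ds.
  have s3 : (s ^+ 3) y != 0.
    by rewrite exprfctE expf_neq0// sqrt_speed_neq0 ?gt_eqF.
  have dk := is_deriveM da (is_deriveV s3 ds3).
  rewrite derive1E curvatureE.
  rewrite (_ : (fun y => _) = (fun y => ((s ^+ 3) y)^-1)); last first.
    by apply/funext => z; rewrite exprfctE.
  by rewrite (derive_val (is_derive := dk)) !exprfctE.
suff cK : {for x, continuous K}.
  apply: (@cvg_trans _ (K @ x)); first by apply: near_eq_cvg; apply: filterS KE.
  by rewrite -(nbhs_singleton KE); exact: cK.
have s3N0 : s x ^+ 3 != 0 by rewrite expf_neq0// sqrt_speed_neq0.
have cs' : {for x, continuous s'}.
  apply: cvgM.
    apply: cvgV; first by rewrite mulf_neq0 ?pnatr_eq0// sqrt_speed_neq0.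
    exact: cvgM (cvg_cst _) csqrt.
  by apply: cvgD; apply: cvgD; apply: cvgM; (exact: cg1 || exact: cg2).
have carea' : {for x, continuous area'}.
  by apply: cvgB; apply: cvgD; apply: cvgM; (exact: cg1 || exact: cg2).
apply: cvgD; apply: cvgM => //; last by apply: cvgV => //; exact: csqrtX.
apply: cvgM; last by apply: cvgM cs'; apply: cvgM; [exact: cvg_cst|exact: csqrtX].
apply: cvgN; apply: cvgV; first by rewrite expf_neq0.
exact: (continuous_comp (csqrtX 3) (@exprn_continuous _ 2 _)).
Qed.

End RegularityOfTheCoefficients.

(** * Integrals over [a, b] and polynomial moments *)

Section Integrals.
Context {R : realType}.
Variables (a b : R).
Hypothesis ab : a < b.

Definition itg (f : R -> R) : R := \int[lebesgue_measure]_(x in `[a, b]) f x.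

(** Continuity is two-sided even at the endpoints, in accordance with [Cn_on], which speaks of
    neighbourhoods. *)
Definition cont_on (f : R -> R) :=
  forall x, a <= x <= b -> {for x, continuous f}.

Let itvP x : `[a, b]%classic x -> a <= x <= b.
Proof. by rewrite /= in_itv. Qed.

Lemma eq_itg (f f' : R -> R) :
  (forall x, a <= x <= b -> f x = f' x) -> itg f = itg f'.
Proof.
move=> ff'; apply: eq_Rintegral => x; rewrite inE /= in_itv /=.
exact: ff'.
Qed.

Lemma cont_on_integrable f :
  cont_on f -> lebesgue_measure.-integrable `[a, b] (EFin \o f).
Proof.
move=> cf; apply: continuous_compact_integrable; first exact: segment_compact.
by apply: continuous_in_subspaceT => x /set_mem /itvP; exact: cf.
Qed.

Lemma itg_linear c (f f' : R -> R) : cont_on f -> cont_on f' ->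
  itg (fun x => c * f x + f' x) = c * itg f + itg f'.
Proof.
move=> cf cf'; rewrite /itg RintegralD //; last exact: cont_on_integrable.
  by rewrite RintegralZl//; exact: cont_on_integrable.
by apply: (cont_on_integrable (fun x => c * f x)) => x /cf; apply: cvgM; exact: cvg_cst.
Qed.

Lemma itg_sum (I : finType) (c : I -> R) (f : I -> R -> R) :
  (forall i, cont_on (f i)) ->
  itg (fun x => \sum_i c i * f i x) = \sum_i c i * itg (f i).
Proof.
move=> cf; rewrite /index_enum; elim: (Finite.enum I) => [|i s IH].
  rewrite (@eq_itg _ (fun=> 0)) => [|x _]; last by rewrite big_nil.
  by rewrite big_nil /itg Rintegral_cst//= mul0r.
under [LHS]eq_itg => x _ do rewrite big_cons.
rewrite (itg_linear (c i) (f i)) ?IH ?big_cons// => x xab.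
apply: cvg_big => [|j _]; first exact: add_continuous.
exact: cvgM (cvg_cst _) (cf j x xab).
Qed.

Lemma itg_moments (f : R -> R) (n : nat) (q : {poly R}) :
  cont_on f -> (size q <= n)%N ->
  itg (fun x => f x * q.[x]) =
  \sum_(l < n) q`_l * itg (fun x => f x * x ^+ l).
Proof.
move=> cf qn; rewrite -itg_sum => [|l x /cf cfx].
  apply: eq_itg => x _; rewrite (horner_coef_wide x qn) mulr_sumr.
  by apply: eq_bigr => l _; rewrite mulrCA.
exact: cvgM cfx (@exprn_continuous _ _ _).
Qed.

(** The antiderivative with constant term 0: at [i = 0] the quotient by [0%:R] is 0 by
    convention. *)
Let prim (q : {poly R}) : {poly R} :=
  \poly_(i < (size q).+1) (q`_i.-1 / i%:R).

Let deriv_prim q : (prim q)^`() = q.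
Proof.
apply/polyP => i; rewrite coef_deriv coef_poly ltnS /=.
case: ltnP => iq; last by rewrite mul0rn nth_default.
by rewrite -[LHS]mulr_natr divfK// pnatr_eq0.
Qed.

(** An antiderivative [P] of the square of [q] is nondecreasing and takes equal values at [a] and
    [b]; it is therefore constant, and its derivative vanishes. *)
Lemma itg_sqr_eq0 (q : {poly R}) : itg (fun x => q.[x] * q.[x]) = 0 -> q = 0.
Proof.
move=> q0; pose P := prim (q * q).
have dP (x : R) : derive1 (horner P) x = (q * q).[x] by rewrite -derivE deriv_prim.
have cP (A : set R) r : {within A, continuous (horner r)}.
  exact/continuous_subspaceT/continuous_horner.
have dvP x : derivable (horner P) x 1 by exact: derivable_horner.
have Pab : P.[b] = P.[a].
  apply/eqP; rewrite -subr_eq0; apply/eqP; move: q0; rewrite /itg /Rintegral.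
  under eq_integral do rewrite -hornerM.
  rewrite (@continuous_FTC2 _ _ (horner P))//.
  by split=> //; [apply: cvg_at_right_filter|apply: cvg_at_left_filter];
    exact: continuous_horner.
have P_homo := @ger0_derive1_le_cc _ (horner P) a b (fun x _ => dvP x) _ (cP _ _).
have dP0 x : x \in `]a, b[ -> 0 <= derive1 (horner P) x.
  by rewrite dP hornerM -expr2 sqr_ge0.
have Pcst : P - (P.[a])%:P = 0.
  apply: (poly_vanish_itv _ a b ab) => x /andP[ax xb].
  rewrite hornerD hornerN hornerC; apply/eqP; rewrite subr_eq0 eq_le.
  by rewrite -{1}Pab !P_homo ?in_itv/= ?lexx ?(ltW ab) ?(ltW ax) ?(ltW xb).
have : (P - (P.[a])%:P)^`() = 0 by rewrite Pcst deriv0.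
by rewrite derivB derivC subr0 deriv_prim => /eqP; rewrite mulf_eq0 orbb => /eqP.
Qed.

(** By linearity it is enough to test against the monomials, and the jump then splits into the
    moments of the two sides. *)
Lemma jump_orthogonalP (m : nat) (wp wm : R * R -> R) :
  cont_on (fun x => wp (0, x)) -> cont_on (fun x => wm (0, x)) ->
  jump_orthogonal m a b wp wm <->
  forall l : 'I_m.+1, itg (fun x => wp (0, x) * x ^+ l) =
                      itg (fun x => wm (0, x) * x ^+ l).
Proof.
move=> cp cm.
have cj : cont_on (jump wp wm) by move=> x xab; exact: cvgB (cp x xab) (cm x xab).
have cX f (l : nat) : cont_on f -> cont_on (fun x => f x * x ^+ l).
  by move=> cf x /cf cfx; exact: cvgM cfx (@exprn_continuous _ _ _).
have momentE (l : nat) : itg (fun x => jump wp wm x * x ^+ l) =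
    itg (fun x => wp (0, x) * x ^+ l) - itg (fun x => wm (0, x) * x ^+ l).
  rewrite -(mulN1r (itg _)) addrC -itg_linear; [|exact: cX..].
  by apply: eq_itg => x _; rewrite /jump; ring.
split=> [jo l|eqm v [q [qm vE]]].
  apply/eqP; rewrite -subr_eq0 -momentE; apply/eqP; apply: jo.
  exists 'X^l; split=> [|x _]; last by rewrite hornerXn.
  by rewrite size_polyXn ltnS -ltnS.
rewrite -/(itg _) (@eq_itg _ (fun x => jump wp wm x * q.[x])) => [|x xab]; last first.
  by rewrite vE// in_itv.
rewrite (itg_moments _ _ _ cj qm) big1// => l _.
by rewrite momentE eqm subrr mulr0.
Qed.

End Integrals.

(** * Coefficient matrices as bivariate polynomials *)

Section MatrixPolynomials.
Context {R : realType} {m : nat}.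
Implicit Types C D : 'M[R]_m.+1.

(** Row [k] lists the xi-coefficients of the factor of eta^k. *)
Definition mxbipoly C : {poly {poly R}} :=
  \poly_(k < m.+1) rVpoly (row (inord k) C).

Lemma coef_mxbipoly C (k : 'I_m.+1) : (mxbipoly C)`_k = rVpoly (row k C).
Proof. by rewrite coef_poly ltn_ord inord_val. Qed.

Lemma mxbipoly_default C k : (m < k)%N -> (mxbipoly C)`_k = 0.
Proof. by move=> mk; rewrite coef_poly ltnS leqNgt mk. Qed.

Lemma size_coef_mxbipoly C k : (size ((mxbipoly C)`_k)%R <= m.+1)%N.
Proof.
case: (ltnP m k) => [mk|km]; first by rewrite mxbipoly_default ?size_poly0.
have -> : k = Ordinal (km : (k < m.+1)%N) by [].
by rewrite coef_mxbipoly size_poly.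
Qed.

Lemma coef2_mxbipoly C (k l : 'I_m.+1) : ((mxbipoly C)`_k)`_l = C k l.
Proof. by rewrite coef_mxbipoly coef_rVpoly_ord mxE. Qed.

Lemma mxbipoly_linear c C D :
  mxbipoly (c *: C + D) = c%:P *: mxbipoly C + mxbipoly D.
Proof.
apply/polyP => k; rewrite coefD coefZ; case: (ltnP m k) => [mk|km].
  by rewrite !mxbipoly_default// mulr0 addr0.
have -> : k = Ordinal (km : (k < m.+1)%N) by [].
by rewrite !coef_mxbipoly linearP /= linearP /= mul_polyC.
Qed.

Lemma evalQE C : evalQ C = bipoly (mxbipoly C).
Proof.
apply/funext => -[e x]; rewrite bipolyE /evalQ /= horner_poly horner_sum.
apply: eq_bigr => k _; rewrite inord_val hornerM horner_exp hornerC.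
rewrite (horner_coef_wide x (size_poly _ _)) mulr_suml.
by apply: eq_bigr => l _; rewrite coef_rVpoly_ord mxE mulrAC.
Qed.

Lemma evalQ_horner C e x :
  evalQ C (e, x) = \sum_(k < m.+1) (rVpoly (row k C)).[x] * e ^+ k.
Proof.
rewrite /evalQ; apply: eq_bigr => k _ /=.
rewrite (horner_coef_wide x (size_poly _ _)) mulr_suml.
by apply: eq_bigr => l _; rewrite coef_rVpoly_ord mxE mulrAC.
Qed.

Lemma evalQ_linear c C D z : evalQ (c *: C + D) z = c * evalQ C z + evalQ D z.
Proof.
by rewrite !evalQE mxbipoly_linear /bipoly slice_linear hornerD hornerZ.
Qed.

(** For each xi the difference vanishes on an interval of eta, so all its eta-coefficients vanish at
    that xi; as polynomials in xi they are then zero on [a, b]. *)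
Lemma evalQ_inj C D (h a b : R) : 0 < h -> a < b ->
  (forall e x, - h < e < 0 -> a <= x <= b -> evalQ C (e, x) = evalQ D (e, x)) ->
  C = D.
Proof.
move=> h0 ab eCD; apply/eqP; rewrite -subr_eq0; apply/eqP.
have E0 e x : - h < e < 0 -> a <= x <= b -> evalQ (C - D) (e, x) = 0.
  move=> eh xab; rewrite -scaleN1r addrC evalQ_linear (eCD e x eh xab).
  by rewrite mulN1r addNr.
move: E0; set E := C - D => E0; apply/matrixP => k l; rewrite [RHS]mxE.
suff E1 : (mxbipoly E)`_k = 0 by rewrite -(coef2_mxbipoly E) E1 coef0.
apply: (poly_vanish_itv _ a b ab) => x /andP[/ltW ax /ltW xb].
suff -> : ((mxbipoly E)`_k).[x] = (slice x (mxbipoly E))`_k.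
  rewrite (_ : slice _ _ = 0) ?coef0//.
  have Nh : - h < 0 by rewrite oppr_lt0.
  apply: (poly_vanish_itv _ _ _ Nh) => e eh.
  by rewrite -(E0 e x eh) ?ax// evalQE.
by rewrite coef_slice.
Qed.

End MatrixPolynomials.

(** * The moment map and the jump conditions *)

Section Moments.
Context {R : realType} {m : nat}.
Variables (g : R -> R * R) (a b : R).
Hypothesis ctrace : forall n S, cont_on a b (trace g n S).
Implicit Types C D : 'M[R]_m.+1.

Definition moment_mx C : 'M[R]_m.+1 :=
  \matrix_(n, l) itg a b (fun x => trace g n (mxbipoly C) x * x ^+ l).

Lemma moment_mxE C n l :
  moment_mx C n l = itg a b (fun x => trace g n (mxbipoly C) x * x ^+ l).
Proof. by rewrite mxE. Qed.

Let ctraceX n S (l : nat) : cont_on a b (fun x => trace g n S x * x ^+ l).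
Proof.
by move=> x xab; exact: cvgM (ctrace n S x xab) (@exprn_continuous _ _ _).
Qed.

Lemma moment_mx_linear : linear moment_mx.
Proof.
move=> c C D; apply/matrixP => n l.
rewrite [RHS]mxE [(c *: moment_mx C) n l]mxE.
have L := itg_linear _ _ c _ _ (ctraceX n (mxbipoly C) l) (ctraceX n (mxbipoly D) l).
apply: etrans (moment_mxE _ _ _) _.
apply: etrans (esym (congr2 (fun s t => c * s + t)
  (moment_mxE C n l) (moment_mxE D n l))).
apply: etrans L; apply: eq_itg => x _.
rewrite mxbipoly_linear trace_linear; ring.
Qed.

(** The jump of the value carries no factor beta; all the other jumps do. *)
Definition jump_weight (beta : R) (n : nat) : R := if n == 0%N then 1 else beta.

(** Brings the three kinds of jump condition to one form, solvable by inverting [moment_mx]. *)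
Lemma ife_spaceP (betap betam h : R) (phi : R * R -> R) : (0 < m)%N ->
  ife_space g betap betam m h a b phi <->
  exists Cp Cm : 'M[R]_m.+1,
    [/\ forall z, fict_elt_plus h a b z -> phi z = evalQ Cp z,
        forall z, fict_elt_minus h a b z -> phi z = evalQ Cm z &
        forall n l : 'I_m.+1, jump_weight betap n * moment_mx Cp n l
                    = jump_weight betam n * moment_mx Cm n l].
Proof.
move=> m0.
have cT beta n S : cont_on a b (fun x => beta * trace g n S x).
  by move=> x xab; exact: cvgM (cvg_cst _) (ctrace n S x xab).
have scale beta C (n l : 'I_m.+1) :
    itg a b (fun x => beta * trace g n (mxbipoly C) x * x ^+ l)
    = beta * moment_mx C n l.
  rewrite moment_mxE -[RHS]addr0 -[X in _ + X](_ : itg a b (fun=> 0) = 0).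
    rewrite -(itg_linear _ _ beta (fun x => trace g n (mxbipoly C) x * x ^+ l)
      (fun=> 0)) //; last by move=> x _; exact: cvg_cst.
    by apply: eq_itg => x _; rewrite addr0 mulrA.
  by rewrite /itg Rintegral_cst//= mul0r.
have jumpP beta beta' C C' (n : 'I_m.+1) (wp wm : R * R -> R) :
    (forall x, wp (0, x) = beta * trace g n (mxbipoly C) x) ->
    (forall x, wm (0, x) = beta' * trace g n (mxbipoly C') x) ->
    jump_orthogonal m a b wp wm <->
    forall l, beta * moment_mx C n l = beta' * moment_mx C' n l.
  move=> wpE wmE.
  have cp : cont_on a b (fun x => wp (0, x)).
    by rewrite (funext wpE); exact: cT.
  have cm : cont_on a b (fun x => wm (0, x)).
    by rewrite (funext wmE); exact: cT.
  have Ep (l : 'I_m.+1) :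
      itg a b (fun x => wp (0, x) * x ^+ l) = beta * moment_mx C n l.
    by apply: etrans (scale _ _ _ _); apply: eq_itg => x _; rewrite wpE.
  have Em (l : 'I_m.+1) :
      itg a b (fun x => wm (0, x) * x ^+ l) = beta' * moment_mx C' n l.
    by apply: etrans (scale _ _ _ _); apply: eq_itg => x _; rewrite wmE.
  apply: iff_trans (jump_orthogonalP _ _ _ _ _ cp cm) _.
  by split=> H l; have := H l; rewrite Ep Em.
have jump0 C C' := jumpP 1 1 C C' ord0 (evalQ C) (evalQ C').
(* [m0] makes 1 a legitimate row index. *)
have jump1 C C' := jumpP betap betam C C' (Ordinal (m0 : (1 < m.+1)%N))
  (fun z => betap * d_eta (evalQ C) z) (fun z => betam * d_eta (evalQ C') z).
have jump2 C C' (j : nat) (jm : (j.+2 < m.+1)%N) := jumpP betap betam C C' (Ordinal jm)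
  (fun z => betap * iter j (@d_eta R) (opL g (evalQ C)) z)
  (fun z => betam * iter j (@d_eta R) (opL g (evalQ C')) z).
split=> -[Cp [Cm H]]; exists Cp, Cm.
- case: H => -[repp repm] H0 H1 H2; split; [exact: repp|exact: repm|move=> n l].
  have [n0|[n1|n2]] : n = 0%N :> nat \/ n = 1%N :> nat \/ (1 < n)%N.
    by case: (n : nat) => [|[|k]]; [left|right; left|right; right].
  + have -> : n = ord0 by apply: val_inj.
    apply: (proj1 (jump0 Cp Cm _ _) H0) => x; rewrite evalQE mul1r; exact: trace0E.
  + have -> : n = Ordinal (m0 : (1 < m.+1)%N) by apply: val_inj.
    by apply: (proj1 (jump1 Cp Cm _ _) H1) => x; rewrite evalQE (trace1E g).
  (* This row tests the eta-derivative of order [n.-2] of L. *)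
  + have jm : (n.-2.+2 < m.+1)%N by have := ltn_ord n; lia.
    have -> : n = Ordinal jm by apply: val_inj => /=; lia.
    have jm' : (n.-2 + 2 <= m)%N by lia.
    by apply: (proj1 (jump2 Cp Cm _ _ _ _) (H2 _ jm')) => x; rewrite evalQE trace2E.
- case: H => repp repm H; split; first by split; [exact: repp|exact: repm].
  + apply/(jump0 Cp Cm) => [x|x|l].
    1,2: by rewrite evalQE mul1r; exact: trace0E.
    exact: (H ord0 l).
  + apply/(jump1 Cp Cm) => [x|x|l].
    1,2: by rewrite evalQE (trace1E g).
    exact: (H (Ordinal (m0 : (1 < m.+1)%N)) l).
  + move=> j jm; have jm' : (j.+2 < m.+1)%N by lia.
    apply/(jump2 Cp Cm _ jm') => [x|x|l].
    1,2: by rewrite evalQE trace2E.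
    exact: (H (Ordinal jm') l).
Qed.

Hypothesis ab : a < b.

(** Strong induction on the power of eta: once the lower coefficients vanish, the n-th trace is n!
    times [q], so all moments of [q] up to degree [m] vanish. Expanding one factor of the square of
    [q] shows that its integral is 0. *)
Lemma moment_mx_eq0 C : moment_mx C = 0 -> C = 0.
Proof.
move=> M0; suff S0 n : (mxbipoly C)`_n = 0.
  by apply/matrixP => k l; rewrite -coef2_mxbipoly S0 coef0 mxE.
elim/ltn_ind: n => n IH; case: (ltnP m n) => [mn|nm].
  by rewrite mxbipoly_default.
set q := (mxbipoly C)`_n.
have cq (l : nat) : cont_on a b (fun x => q.[x] * x ^+ l).
  by move=> x _; exact: cvgM (@continuous_horner _ _ _) (@exprn_continuous _ _ _).
apply: (itg_sqr_eq0 _ _ ab).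
rewrite (@itg_moments _ _ _ _ m.+1)//; last 2 first.
- by move=> x _; exact: continuous_horner.
- exact: size_coef_mxbipoly.
rewrite big1// => l _.
suff -> : itg a b (fun x => q.[x] * x ^+ l) = 0 by rewrite mulr0.
have /matrixP/(_ (Ordinal (nm : (n < m.+1)%N)) l) := M0; rewrite [RHS]mxE moment_mxE /=.
(* The added 0 gives the integrand the shape required by [itg_linear]. *)
rewrite (@eq_itg _ _ _ _ (fun x => n`!%:R * (q.[x] * x ^+ l) + 0)); last first.
  by move=> x _; rewrite trace_low// -/q addr0 mulrA mulr_natl.
rewrite (itg_linear _ _ n`!%:R (fun x => q.[x] * x ^+ l) (fun=> 0)) //; last first.
  by move=> x _; exact: cvg_cst.
rewrite {2}/itg Rintegral_cst//= mul0r addr0 => /eqP.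
by rewrite mulf_eq0 pnatr_eq0 -leqn0 leqNgt fact_gt0 => /eqP.
Qed.

Lemma moment_mx_inj : injective moment_mx.
Proof.
move=> C D eCD; apply/eqP; rewrite -subr_eq0; apply/eqP/moment_mx_eq0.
by rewrite -scaleN1r addrC moment_mx_linear eCD scaleN1r addNr.
Qed.

(** An injective endomorphism of a finite-dimensional space is onto. *)
Lemma moment_mx_surj D : exists C, moment_mx C = D.
Proof.
pose L := GRing.isLinear.Build _ _ _ _ moment_mx moment_mx_linear.
pose F : {linear 'M[R]_m.+1 -> 'M[R]_m.+1} := HB.pack moment_mx L.
have F0 : lker (linfun F) == 0%VS.
  by apply/lker0P => C C'; rewrite !lfunE; exact: moment_mx_inj.
exists ((linfun F)^-1%VF D).
by have := lker0_lfunVK F0 D; rewrite lfunE.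
Qed.

End Moments.

(** If [b <= a], the interval has at most one point, where two functions are always dependent. *)
Lemma basis_poly_space_lt {R : realType} (m : nat) (a b : R)
    (p : 'I_m.+1 -> R -> R) :
  (0 < m)%N -> basis_on [set` `[a, b]] (poly_space m a b) p -> a < b.
Proof.
move=> m0 [_ free _]; rewrite ltNge; apply/negP => ba.
have xa x : [set` `[a, b]] x -> x = a.
  rewrite /= in_itv/= => /andP[ax xb]; apply/eqP.
  by rewrite eq_le ax (le_trans xb ba).
pose i0 : 'I_m.+1 := ord0; pose i1 : 'I_m.+1 := Ordinal (m0 : (1 < m.+1)%N).
have sum2 (s t : R) (x : R) :
    \sum_i (if i == i0 then s else if i == i1 then t else 0) * p i x
    = s * p i0 x + t * p i1 x.
  rewrite (bigD1 i0)//= (bigD1 i1)//= big1 ?addr0// => i /andP[/negPf-> /negPf->].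
  by rewrite mul0r.
(* The relation p_1(a) p_0 - p_0(a) p_1 = 0 forces this; then [p i0] alone is a nontrivial
   relation. *)
have p0 : p i0 a = 0.
  have H x : [set` `[a, b]] x -> \sum_i (if i == i0 then p i1 a else
      if i == i1 then - p i0 a else 0) * p i x = 0.
    by move=> /xa ->; rewrite sum2 mulNr mulrC subrr.
  by have := free _ H i1; rewrite /= => /eqP; rewrite oppr_eq0 => /eqP.
have H x : [set` `[a, b]] x -> \sum_i (if i == i0 then 1 else
    if i == i1 then 0 else 0) * p i x = 0.
  by move=> /xa ->; rewrite sum2 p0 mulr0 mul0r addr0.
by have /eqP := free _ H i0; rewrite /= oner_eq0.
Qed.

(** * Coefficient matrices of eta^k q(xi) *)

Section RowMatrix.
Context {R : realType} {m : nat}.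
Implicit Types (q : {poly R}) (k : 'I_m.+1).

Definition row_mx_of k q : 'M[R]_m.+1 :=
  \matrix_(i, j) (if i == k then q`_j else 0).

Lemma rVpoly_row_mx_of k q i : (size q <= m.+1)%N ->
  rVpoly (row i (row_mx_of k q)) = if i == k then q else 0.
Proof.
move=> qm; rewrite (_ : row _ _ = if i == k then poly_rV q else 0).
  by case: eqP => _; rewrite ?linear0// poly_rV_K.
by apply/rowP => j; rewrite !mxE; case: (i == k); rewrite mxE.
Qed.

Lemma evalQ_row_mx_of k q e x : (size q <= m.+1)%N ->
  evalQ (row_mx_of k q) (e, x) = e ^+ k * q.[x].
Proof.
move=> qm; rewrite evalQ_horner (bigD1 k)//= rVpoly_row_mx_of// eqxx mulrC.
rewrite big1 ?addr0// => i /negPf ik.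
by rewrite rVpoly_row_mx_of// ik horner0 mul0r.
Qed.

End RowMatrix.

(** * Structure of the immersed finite element space *)

Section ImmersedSpace.
Context {R : realType} (m : nat).
Variables (g : R -> R * R) (betap betam h a b : R).
Hypotheses (m0 : (0 < m)%N) (bp0 : 0 < betap) (bm0 : 0 < betam).
Hypotheses (h0 : 0 < h) (ab : a < b).
Hypothesis ctrace : forall n S, cont_on a b (trace g n S).

Let W := ife_space g betap betam m h a b.
Let M := @moment_mx R m g a b.
Let WP phi := ife_spaceP g a b ctrace betap betam h phi m0.

Let Mlin c C D : M (c *: C + D) = c *: M C + M D.
Proof. exact: moment_mx_linear. Qed.

Let M0 : M 0 = 0.
Proof. by have := Mlin (-1) 0 0; rewrite scaler0 addr0 scaleN1r addNr. Qed.

Let MZ c C : M (c *: C) = c *: M C.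
Proof. by rewrite -[c *: C]addr0 Mlin M0 addr0. Qed.

Let weight_neq0 (beta : R) n : 0 < beta -> jump_weight beta n != 0.
Proof.
by move=> b0; rewrite /jump_weight; case: (n == _); rewrite ?oner_neq0 ?gt_eqF.
Qed.

Let fict_case z : fict_elt h a b z ->
  fict_elt_minus h a b z \/ fict_elt_plus h a b z.
Proof. by move=> Dz; case: (ltP z.1 0) => z0; [left|right]. Qed.

Let fict_itv z : fict_elt h a b z -> a <= z.2 <= b.
Proof. by move=> -[_] /=; rewrite in_itv. Qed.

Let minus_mem (e x : R) : - h < e < 0 -> a <= x <= b -> fict_elt_minus h a b (e, x).
Proof.
move=> /andP[he e0] xab; split=> //; split=> /=; rewrite in_itv//=.
by rewrite (ltW he) (ltW (lt_trans e0 h0)).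
Qed.

Lemma ife_space0 : W (fun=> 0).
Proof.
apply/WP; exists 0, 0; split=> [z _|z _|n l].
- by rewrite /evalQ big1// => k _; rewrite big1// => l _; rewrite mxE !mul0r.
- by rewrite /evalQ big1// => k _; rewrite big1// => l _; rewrite mxE !mul0r.
- by rewrite -/(M 0) M0 mxE !mulr0.
Qed.

Lemma ife_spaceD c phi phi' :
  W phi -> W phi' -> W (fun z => c * phi z + phi' z).
Proof.
move=> /WP[Cp [Cm [rp rm eM]]] /WP[Cp' [Cm' [rp' rm' eM']]].
apply/WP; exists (c *: Cp + Cp'), (c *: Cm + Cm'); split=> [z Dz|z Dz|n l].
- by rewrite evalQ_linear rp// rp'.
- by rewrite evalQ_linear rm// rm'.
- have E C C' : M (c *: C + C') n l = c * M C n l + M C' n l.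
    by rewrite (Mlin c C C') mxE; congr (_ + _); rewrite mxE.
  have comb (w w' x x' y y' : R) : w * x = w' * y -> w * x' = w' * y' ->
      w * (c * x + x') = w' * (c * y + y').
    by move=> e1 e2; rewrite !mulrDr e2 mulrCA e1 mulrCA.
  apply: (etrans (congr1 (fun t => jump_weight betap n * t) (E Cp Cp'))).
  apply: etrans (comb _ _ _ _ _ _ (eM n l) (eM' n l)) _.
  exact: (esym (congr1 (fun t => jump_weight betam n * t) (E Cm Cm'))).
Qed.

Lemma ife_space_sum (I : finType) (c : I -> R) (phi : I -> R * R -> R) :
  (forall i, W (phi i)) -> W (fun z => \sum_i c i * phi i z).
Proof.
move=> Wphi; rewrite /index_enum; elim: (Finite.enum I) => [|i s IH].
  by under [X in W X]eq_fun do rewrite big_nil; exact: ife_space0.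
by under [X in W X]eq_fun do rewrite big_cons; exact: ife_spaceD.
Qed.

(** The minus side determines [Cm]; the nonzero weights and injectivity of the moment map then
    determine [Cp]. *)
Lemma ife_space_minus_inj phi phi' : W phi -> W phi' ->
  (forall z, fict_elt_minus h a b z -> phi z = phi' z) ->
  forall z, fict_elt h a b z -> phi z = phi' z.
Proof.
move=> /WP[Cp [Cm [rp rm eM]]] /WP[Cp' [Cm' [rp' rm' eM']]] minusE.
have Em : Cm = Cm'.
  apply: (evalQ_inj _ _ _ _ _ h0 ab) => e x eh xab.
  have Dz := minus_mem _ _ eh xab.
  by rewrite -rm// -rm'//; exact: minusE.
have Ep : Cp = Cp'.
  apply: (moment_mx_inj g a b ctrace ab); apply/matrixP => n l.
  apply: (mulfI (weight_neq0 _ n bp0)).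
  by apply: etrans (eM n l) _; rewrite Em; exact: esym (eM' n l).
move=> z /fict_case[Dz|Dz]; first exact: minusE.
by rewrite rp// rp'// Ep.
Qed.

(** Surjectivity of the moment map solves the jump equations for [Cp], with the right-hand side [D]
    prescribed by [Cm]. *)
Lemma ife_space_extend (Cm : 'M[R]_m.+1) : exists2 phi, W phi &
  forall z, fict_elt_minus h a b z -> phi z = evalQ Cm z.
Proof.
pose D : 'M[R]_m.+1 :=
  \matrix_(n, l) ((jump_weight betap n)^-1 * (jump_weight betam n * M Cm n l)).
have [Cp MCp] := moment_mx_surj g a b ctrace ab D.
exists (fun z => if z.1 < 0 then evalQ Cm z else evalQ Cp z); last first.
  by move=> z [_ /= ->].
apply/WP; exists Cp, Cm; split=> [z [_ /=]|z [_ /= ->//]|n l].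
  by rewrite ltNge => ->.
by rewrite MCp mxE mulrA divff ?mul1r// weight_neq0.
Qed.

Variable p : 'I_m.+1 -> R -> R.
Hypothesis pbasis : basis_on [set` `[a, b]] (poly_space m a b) p.

Let q_ex : {q : 'I_m.+1 -> {poly R} & forall i,
  (size (q i) <= m.+1)%N /\ forall x, a <= x <= b -> p i x = (q i).[x]}.
Proof.
apply: (@choice _ _ (fun i (q : {poly R}) => (size q <= m.+1)%N /\
  forall x, a <= x <= b -> p i x = q.[x])) => i.
have [pS _ _] := pbasis; have [q [qm pE]] := pS i.
by exists q; split=> // x xab; apply: pE; rewrite in_itv.
Qed.

Lemma ife_extension_exists i :
  exists phi, ife_extension g betap betam m h a b (p i) phi.
Proof.
have [q /(_ i) [qm qE]] := q_ex.
have [phi Wphi phiE] := ife_space_extend (row_mx_of ord0 (q i)).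
exists phi; split=> // -[e x] Dz.
by rewrite phiE// evalQ_row_mx_of// expr0 mul1r qE//; case: Dz => /fict_itv.
Qed.

Lemma ife_extension_unique i phi phi' :
  ife_extension g betap betam m h a b (p i) phi ->
  ife_extension g betap betam m h a b (p i) phi' ->
  forall z, fict_elt h a b z -> phi z = phi' z.
Proof.
move=> [Wphi phiE] [Wphi' phiE']; apply: ife_space_minus_inj => // z Dz.
by rewrite phiE// phiE'.
Qed.

(** Both pieces are the same matrix [E] divided by beta. In rows [n > 0] the weight cancels this
    division; in row 0 both sides vanish because eta^j is 0 at eta = 0. *)
Lemma ife_space_monomial (i j : 'I_m.+1) : j != ord0 ->
  W (fun z => (beta_hat betap betam z)^-1 * z.1 ^+ j * p i z.2).
Proof.
move=> j0; have [q /(_ i) [qm qE]] := q_ex.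
pose E := row_mx_of j (q i).
have EE c z : fict_elt h a b z ->
    c * z.1 ^+ j * p i z.2 = evalQ (c *: E) z.
  case: z => e x /fict_itv /= xab.
  rewrite -[c *: E]addr0 evalQ_linear evalQ_row_mx_of// qE// -mulrA.
  rewrite [evalQ 0 _](_ : _ = 0) ?addr0// /evalQ big1// => k _.
  by rewrite big1// => l _; rewrite mxE !mul0r.
apply/WP; exists (betap^-1 *: E), (betam^-1 *: E); split.
- by move=> z [Dz /= z0]; rewrite -EE// /beta_hat ltNge z0.
- by move=> z [Dz /= z0]; rewrite -EE// /beta_hat z0.
- move=> n l.
  have sc c : M (c *: E) n l = c * M E n l by rewrite (MZ c E) mxE.
  apply: (etrans (congr1 (fun t => jump_weight betap n * t) (sc _))).
  apply: (etrans _ (esym (congr1 (fun t => jump_weight betam n * t) (sc _)))).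
  rewrite /jump_weight; case: (altP (n =P 0%N :> nat)) => [n0|_]; last first.
    by rewrite !mulrA !divff ?gt_eqF.
  suff -> : M E n l = 0 by rewrite !mulr0.
  rewrite /M moment_mxE n0 (@eq_itg _ _ _ _ (fun=> 0)) => [|x _].
    by rewrite /itg Rintegral_cst//= mul0r.
  rewrite /= (coef_mxbipoly _ ord0) rVpoly_row_mx_of//.
  by rewrite eq_sym (negPf j0) horner0 mul0r.
Qed.

(** * The family as a basis *)

Section Basis.
Variable phi0 : 'I_m.+1 -> R * R -> R.
Hypothesis phi0E : forall i, ife_extension g betap betam m h a b (p i) (phi0 i).

Let fam := ife_family betap betam p phi0.

(** On the minus side the member of index (i, j) is p_i eta^j, divided by [betam] except when
    [j = 0]; [jump_weight] encodes this exception too. *)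
Let sum_fam (c : 'I_m.+1 * 'I_m.+1 -> R) z : fict_elt_minus h a b z ->
  \sum_ij c ij * fam ij z =
  \sum_(j < m.+1)
    ((jump_weight betam j)^-1 * \sum_i c (i, j) * p i z.2) * z.1 ^+ j.
Proof.
move=> Dz; rewrite (eq_bigr (fun ij => c (ij.1, ij.2) * fam (ij.1, ij.2) z));
  last by case.
rewrite -(pair_bigA _ (fun i j => c (i, j) * fam (i, j) z)) /=.
rewrite exchange_big /=; apply: eq_bigr => j _.
rewrite mulr_sumr mulr_suml; apply: eq_bigr => i _.
rewrite /fam /ife_family /jump_weight /=; case: (eqVneq j ord0) => [->|j0].
  by rewrite eqxx invr1 mul1r expr0 mulr1; case: (phi0E i) => _ ->.
rewrite (_ : (j == 0%N :> nat) = false); last by apply/negbTE.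
case: Dz => _ /= z0; rewrite /beta_hat z0; ring.
Qed.

Lemma ife_family_in ij : W (fam ij).
Proof.
case: ij => i j; rewrite /fam /ife_family /=.
by case: (eqVneq j ord0) => [_|j0]; [case: (phi0E i)|exact: ife_space_monomial].
Qed.

Lemma ife_family_free (c : 'I_m.+1 * 'I_m.+1 -> R) :
  (forall z, fict_elt h a b z -> \sum_ij c ij * fam ij z = 0) ->
  forall ij, c ij = 0.
Proof.
move=> c0 [i j]; have [_ free _] := pbasis.
apply: (free (fun i => c (i, j))) => x; rewrite /= in_itv /= => xab.
(* At fixed xi the combination is this polynomial in eta; its coefficients vanish, which leaves
   relations among the [p i]. *)
pose Q : {poly R} := \poly_(k < m.+1)
  ((jump_weight betam k)^-1 * \sum_i c (i, inord k) * p i x).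
have Nh : - h < 0 by rewrite oppr_lt0.
have Q0 : Q = 0.
  apply: (poly_vanish_itv _ _ _ Nh) => e eh.
  have Dz := minus_mem _ _ eh xab.
  rewrite -(c0 (e, x)); last by case: Dz.
  rewrite sum_fam// horner_poly; apply: eq_bigr => k _.
  by rewrite inord_val.
have := congr1 (fun P : {poly R} => P`_j) Q0.
rewrite coef0 coef_poly ltn_ord inord_val => /eqP.
by rewrite mulf_eq0 invr_eq0 (negPf (weight_neq0 _ _ bm0)) => /eqP.
Qed.

Lemma ife_family_span f : W f ->
  exists c : 'I_m.+1 * 'I_m.+1 -> R,
    forall z, fict_elt h a b z -> f z = \sum_ij c ij * fam ij z.
Proof.
move=> Wf; have /WP[Cp [Cm [rp rm eM]]] := Wf.
have [d dE] : {d : 'I_m.+1 -> 'I_m.+1 -> R & forall j x, a <= x <= b ->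
    (rVpoly (row j Cm)).[x] = \sum_i d j i * p i x}.
  apply: (@choice _ _ (fun j (d : 'I_m.+1 -> R) => forall x, a <= x <= b ->
    (rVpoly (row j Cm)).[x] = \sum_i d i * p i x)) => j.
  have [_ _ span] := pbasis.
  have [|c cE] := span (horner (rVpoly (row j Cm))).
    by exists (rVpoly (row j Cm)); split=> //; exact: size_poly.
  by exists c => x xab; apply: cE; rewrite /= in_itv.
(* The weight compensates the inverse in [sum_fam]; agreement on the minus side then suffices. *)
exists (fun ij : 'I_m.+1 * 'I_m.+1 => jump_weight betam ij.2 * d ij.2 ij.1).
apply: ife_space_minus_inj => //; first by apply: ife_space_sum; exact: ife_family_in.
move=> [e x] Dz; have [/fict_itv /= xab _] := Dz.
rewrite sum_fam// rm// evalQ_horner; apply: eq_bigr => j _.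
congr (_ * _); rewrite dE// mulr_sumr; apply: eq_bigr => i _ /=.
by rewrite -!mulrA mulKf// weight_neq0.
Qed.

End Basis.
End ImmersedSpace.

(** * Application to the geometric setting *)

Lemma continuous_trace_regular {R : realType} (g : R -> R * R) (xs xe a b : R) :
  regular_interface g xs xe -> xs <= a -> b <= xe ->
  forall n S, cont_on a b (trace g n S).
Proof.
move=> greg xsa bxe n S x /andP[ax xb].
have xin : x \in `[xs, xe] by rewrite in_itv/= (le_trans xsa ax) (le_trans xb bxe).
apply: continuous_trace.
- exact: continuous_curvature greg xin.
- exact: continuous_derive_curvature greg xin.
- exact: continuous_inv_speed2 greg xin.
- exact: continuous_dot12 greg xin.
Qed.

Theorem corollary1 (R : realType) (m : nat)
    (lo hi : R * R) (g : R -> R * R) (xs xe eps : R)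
    (Omegap Omegam : set (R * R)) (betap betam : R) (beta : R * R -> R)
    (nx ny : nat) (h : R) (k l : nat)
    (xi : bool * bool -> R) (a b : R)
    (p : 'I_m.+1 -> R -> R) :
  (1 <= m)%N ->
  regular_interface g xs xe ->
  divides lo hi (curve g xs xe) Omegap Omegam ->
  piecewise_const Omegap Omegam betap betam beta ->
  tubular_assumptions g xs xe eps ->
  (* uniform mesh of diameter h *)
  (0 < nx)%N -> (0 < ny)%N ->
  h = enorm (mesh_step lo hi nx ny) -> h < eps ->
  (* interface element and its fictitious element *)
  (k < nx)%N -> (l < ny)%N ->
  interface_element (curve g xs xe) (mesh_cell lo hi nx ny k l) ->
  (forall s, nearest_param g xs xe (cell_vertex lo hi nx ny k l s) (xi s)) ->
  a = \big[Num.min/xi (false, false)]_s xi s ->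
  b = \big[Num.max/xi (false, false)]_s xi s ->
  basis_on [set` `[a, b]] (poly_space m a b) p ->
  (* existence and uniqueness (on the fictitious element) of each phi_{i,0} *)
  (forall i : 'I_m.+1,
     (exists phi, ife_extension g betap betam m h a b (p i) phi) /\
     (forall phi phi',
        ife_extension g betap betam m h a b (p i) phi ->
        ife_extension g betap betam m h a b (p i) phi' ->
        forall z, fict_elt h a b z -> phi z = phi' z)) /\
  (forall phi0 : 'I_m.+1 -> R * R -> R,
     (forall i, ife_extension g betap betam m h a b (p i) (phi0 i)) ->
     basis_on (fict_elt h a b) (ife_space g betap betam m h a b)
              (ife_family betap betam p phi0)).
Proof.
move=> m0 greg [[lo1 lo2] _] [bp0 bm0 _ _] _ nx0 ny0 hE _ _ _ _ xiP aE bE pbasis.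
have ab : a < b := basis_poly_space_lt m a b p m0 pbasis.
have xi_in s : xs <= xi s <= xe by have [+ _] := xiP s; rewrite in_itv.
(* The default value of the iterated minimum is itself one of the parameters, so the bound covers it
   as well. *)
have xsa : xs <= a.
  rewrite aE; elim/big_ind: _ => [|y z ys zs|s _]; last by case/andP: (xi_in s).
    by case/andP: (xi_in (false, false)).
  by rewrite le_min ys.
have bxe : b <= xe.
  rewrite bE; elim/big_ind: _ => [|y z ys zs|s _]; last by case/andP: (xi_in s).
    by case/andP: (xi_in (false, false)).
  by rewrite ge_max ys.
have ctr := continuous_trace_regular g xs xe a b greg xsa bxe.
have h0 : 0 < h.
  rewrite hE sqrtr_gt0 ltr_pwDl ?sqr_ge0// exprn_gt0//.
  by rewrite divr_gt0 ?subr_gt0 ?ltr0n.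
split=> [i|phi0 phi0E].
  split; first exact: ife_extension_exists.
  exact: ife_extension_unique.
split.
- exact: (ife_family_in m g betap betam h a b m0 bp0 bm0 ctr p pbasis phi0 phi0E).
- exact: (ife_family_free m g betap betam h a b bm0 h0 p pbasis phi0 phi0E).
- exact: (ife_family_span m g betap betam h a b m0 bp0 bm0 h0 ab ctr p pbasis
    phi0 phi0E).
Qed.
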